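(* The normal fan of a standard cut $n$-dimensional double path hypercube graph associahedron is equal, under the linear identification $e_i\mapsto\alpha_i$ ($1\le i\le n$), to the linear $c$-bicluster fan of type $A_n$, where $c=s_1s_2\cdots s_n$.
   Context: Let $\pm[n]=\{-n,\dots,-1,1,\dots,n\}$. The double path hypercube graph is the graph on $\pm[n]$ with edges $\{i,i+1\}$ and $\{-i,-(i+1)\}$ for $1\le i<n$, and no other edges. A tube is a nonempty subset of $\pm[n]$ inducing a connected subgraph and containing no pair $\{i,-i\}$. Two tubes are weakly compatible if one is contained in the other, or they are disjoint with no edge between them. A tubing is a set $T$ of pairwise weakly compatible tubes whose union contains no pair $\{i,-i\}$. A hypercube graph associahedron is a simple $n$-dimensional polytope whose dual simplicial complex (sets of facets with nonempty intersection) is isomorphic to the complex of tubings. With $e_{-i}=-e_i\in\mathbb{R}^n$, it is a standard cut one if its normal fan equals the fan of all cones $\operatorname{Cone}\{\sum_{i\in t}e_i\mid t\in T\}$, $T$ a tubing, where $\operatorname{Cone}$ denotes the set of nonnegative linear combinations. The type $A_n$ root system consists of the vectors $\epsilon_i-\epsilon_j$, $i\neq j$ in $[n+1]$, with $\epsilon_1,\dots,\epsilon_{n+1}$ the standard basis of $\mathbb{R}^{n+1}$; simple roots are $\alpha_i=\epsilon_i-\epsilon_{i+1}$, and $s_i$ is the transposition $(i\;\,i+1)$ permuting coordinates. Fans below live in the span of the roots. An almost positive root is a root that is a nonnegative combination of simple roots or equals some $-\alpha_i$. Let $[\beta:\alpha_i]$ be the coefficient of $\alpha_i$ in $\beta$.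 Define $\sigma_i(\beta)=\beta$ if $\beta=-\alpha_j$ with $j\ne i$, and $\sigma_i(\beta)=s_i\beta$ otherwise. A Coxeter element is a product of $s_1,\dots,s_n$, each once, in some order; $s_i$ is initial in $c$ if some reduced word for $c$ starts with $s_i$. The relations $\|_c$ (one symmetric relation on almost positive roots for each Coxeter element) form the unique family such that (1) $-\alpha_i\,\|_c\,\beta$ iff $[\beta:\alpha_i]=0$ (for $\beta\neq-\alpha_i$); (2) if $s_i$ is initial in $c$, then $\beta_1\|_c\beta_2$ iff $\sigma_i(\beta_1)\,\|_{s_ics_i}\,\sigma_i(\beta_2)$. The $c$-cluster fan consists of the cones $\operatorname{Cone}\{\beta_1,\dots,\beta_k\}$ for all sets of pairwise $\|_c$-compatible almost positive roots. The $c$-bicluster fan is the coarsest common refinement of the $c$-cluster fan and its antipodal inverse $\{-C\}$, i.e. the set of all intersections of a cone of one with a cone of the other. It is called linear when $c=s_1s_2\cdots s_n$. *)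

(* Defs.v *)
From HB Require Import structures.
From mathcomp Require Import all_boot all_order all_algebra.
From mathcomp Require Import perm.
From mathcomp Require Import all_classical all_reals.

Set Implicit Arguments.
Unset Strict Implicit.
Unset Printing Implicit Defensive.

Import Order.TTheory GRing.Theory Num.Theory.

Local Open Scope classical_set_scope.
Local Open Scope card_scope.
Local Open Scope ring_scope.

Section Hulls.
Variables (R : realType) (V : lmodType R).

(* A repeated vector in [s] only has its coefficient multiplied, so the use of
   sequences instead of finite sets does not change the set of combinations. *)
Definition cone (A : set V) : set V :=
  [set x | exists (s : seq V) (a : V -> R),
     (forall v, v \in s -> A v /\ 0 <= a v) /\ x = \sum_(v <- s) a v *: v].

Definition conv_hull (s : seq V) : set V :=
  [set x | exists a : V -> R,
     [/\ forall v, v \in s -> 0 <= a v,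
         \sum_(v <- s) a v = 1 &
         x = \sum_(v <- s) a v *: v]].

End Hulls.

Section Polytopes.
Variables (R : realType) (n : nat).
Local Notation E := 'rV[R]_n.
Implicit Types (P F A : set E) (U W : {vspace E}).

Definition dot (u v : E) : R := \sum_i u 0 i * v 0 i.

Definition polytope P := exists s : seq E, P = conv_hull s.

(* [A] is nonempty and the direction of its affine hull, i.e. the least linear
   subspace containing all the differences [y - x] of points of [A], has
   dimension [d]. *)
Definition has_dim A (d : nat) :=
  exists2 x, A x & exists U, [/\ \dim U = d,
    forall y, A y -> y - x \in U &
    forall W, (forall y, A y -> y - x \in W) -> (U <= W)%VS].

(* Taking [a = 0] shows that [P] is a face of itself; the empty set is not a
   face of a nonempty polytope. *)
Definition face P F :=
  exists a : E, F = [set x | P x /\ forall y, P y -> dot a y <= dot a x].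

Definition facet P F :=
  face P F /\ exists d, has_dim P d.+1 /\ has_dim F d.

Definition simple_polytope P (d : nat) :=
  [/\ polytope P, has_dim P d &
      forall v, face P [set v] -> [set F | facet P F /\ F v] #= `I_d].

Definition normal_cone P F : set E :=
  [set a | forall x y, F x -> P y -> dot a y <= dot a x].

Definition normal_fan P : set (set E) :=
  [set normal_cone P F | F in face P].

(* The intersection of the empty set of facets is [P] itself. *)
Definition dual_complex P : set (set (set E)) :=
  [set S | S `<=` facet P /\ P `&` \bigcap_(F in S) F !=set0].

End Polytopes.

(* An abstract simplicial complex is given by its set of simplices. *)
Definition complex_vertices (A : Type) (K : set (set A)) : set A :=
  [set v | K [set v]].

Definition complex_iso (A B : Type) (K : set (set A)) (L : set (set B)) :=
  exists f : A -> B,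
    set_bij (complex_vertices K) (complex_vertices L) f /\
    forall S, S `<=` complex_vertices K -> (K S <-> L (f @` S)).

(* [(false, i)] stands for [i + 1] and [(true, i)] for [-(i + 1)]. *)
Notation spm n := (bool * 'I_n)%type.

Definition spm_opp (n : nat) (p : spm n) : spm n := (~~ p.1, p.2).

Definition double_path (n : nat) : rel (spm n) :=
  fun p q => (p.1 == q.1) &&
    ((p.2.+1 == q.2 :> nat) || (q.2.+1 == p.2 :> nat)).

Section Tubings.
Variables (n : nat) (g : rel (spm n)).
Implicit Types (t u : {set spm n}) (T : {set {set spm n}}).

Definition induced t : rel (spm n) :=
  fun p q => [&& p \in t, q \in t & g p q].

Definition no_opposite t : Prop :=
  forall p, ~ (p \in t /\ spm_opp p \in t).

Definition tube t : Prop :=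
  [/\ t != finset.set0,
      forall p q, p \in t -> q \in t -> connect (induced t) p q &
      no_opposite t].

Definition weakly_compatible t u : Prop :=
  [\/ t \subset u, u \subset t |
      t :&: u = finset.set0 /\ forall p q, p \in t -> q \in u -> ~~ g p q].

Definition tubing T : Prop :=
  [/\ forall t, t \in T -> tube t,
      forall t u, t \in T -> u \in T -> weakly_compatible t u &
      no_opposite (finset.cover T)].

Definition tubing_complex : set (set {set spm n}) :=
  [set [set` T] | T in [set T | tubing T]].

Variable R : realType.

Definition spm_vec (p : spm n) : 'rV[R]_n := (-1) ^+ p.1 *: delta_mx 0 p.2.

Definition tubing_fan : set (set 'rV[R]_n) :=
  [set cone [set \sum_(p in t) spm_vec p | t in [set` T]]
     | T in [set T | tubing T]].

Definition graph_associahedron (P : set 'rV[R]_n) : Prop :=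
  simple_polytope P n /\ complex_iso (dual_complex P) tubing_complex.

Definition standard_cut_graph_associahedron (P : set 'rV[R]_n) : Prop :=
  graph_associahedron P /\ normal_fan P = tubing_fan.

End Tubings.

Section TypeA.
Variables (R : realType) (n : nat).
Local Notation E := 'rV[R]_n.+1.
Implicit Types (b : E) (c : 'S_n.+1).

Definition ord_lo (i : 'I_n) : 'I_n.+1 := widen_ord (leqnSn n) i.
Definition ord_hi (i : 'I_n) : 'I_n.+1 := lift ord0 i.

Definition root : set E :=
  [set b | exists i j : 'I_n.+1, i != j /\ b = delta_mx 0 i - delta_mx 0 j].

Definition simple_root (i : 'I_n) : E :=
  delta_mx 0 (ord_lo i) - delta_mx 0 (ord_hi i).

Definition simple_refl (i : 'I_n) : 'S_n.+1 := tperm (ord_lo i) (ord_hi i).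

Definition almost_positive_root : set E :=
  [set b | root b /\
     (cone (range simple_root) b \/ exists i, b = - simple_root i)].

(* The coordinate of [b] in the basis of simple roots. *)
Definition root_coef b (i : 'I_n) : R :=
  coord [tuple simple_root j | j < n] i b.

(* [col_perm] lets the transposition [simple_refl i] permute the coordinates. *)
Definition sigma (i : 'I_n) b : E :=
  if [exists j, (j != i) && (b == - simple_root j)] then b
  else col_perm (simple_refl i) b.

(* The product of ['S_n.+1] is read from left to right, as opposed to the
   composition of maps. Everything below only refers to words in the simple
   reflections, and inversion identifies the two conventions while fixing the
   simple reflections, so the resulting notions are the same. *)
Definition word_perm (w : seq 'I_n) : 'S_n.+1 :=
  (\prod_(i <- w) simple_refl i)%g.

Definition reduced_word (w : seq 'I_n) c : Prop :=
  word_perm w = c /\ forall w', word_perm w' = c -> (size w <= size w')%N.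

Definition coxeter_element c : Prop :=
  exists w : seq 'I_n, perm_eq w (enum 'I_n) /\ c = word_perm w.

Definition initial (i : 'I_n) c : Prop :=
  exists w : seq 'I_n, reduced_word (i :: w) c.

(* These conditions determine [compat c b1 b2] for Coxeter elements [c] and
   distinct almost positive roots [b1], [b2], and no other value is used. *)
Definition compatibility_family (compat : 'S_n.+1 -> E -> E -> Prop) : Prop :=
  [/\ forall c b1 b2, coxeter_element c ->
        almost_positive_root b1 -> almost_positive_root b2 ->
        compat c b1 b2 -> compat c b2 b1,
      forall c i b, coxeter_element c -> almost_positive_root b ->
        b <> - simple_root i ->
        (compat c (- simple_root i) b <-> root_coef b i = 0) &
      forall c i b1 b2, coxeter_element c -> initial i c ->
        almost_positive_root b1 -> almost_positive_root b2 ->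
        (compat c b1 b2 <->
         compat (simple_refl i * c * simple_refl i)%g
           (sigma i b1) (sigma i b2))].

Definition pairwise_compatible (r : E -> E -> Prop) (B : set E) : Prop :=
  B `<=` almost_positive_root /\
  forall b1 b2, B b1 -> B b2 -> b1 <> b2 -> r b1 b2.

Definition cluster_fan (r : E -> E -> Prop) : set (set E) :=
  [set cone B | B in pairwise_compatible r].

Definition bicluster_fan (r : E -> E -> Prop) : set (set E) :=
  [set C `&` (-%R @` D) | C in cluster_fan r & D in cluster_fan r].

Definition linear_coxeter : 'S_n.+1 := word_perm (enum 'I_n).

Definition identification (x : 'rV[R]_n) : E :=
  \sum_(i < n) x 0 i *: simple_root i.

End TypeA.

(* Main.v *)
Require Import Defs.
From HB Require Import structures.
From mathcomp Require Import all_boot all_order all_algebra.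
From mathcomp Require Import perm.
From mathcomp Require Import all_classical all_reals.
From mathcomp Require Import zify lra.

(* Positive roots of type [A_n] are the intervals of [1, n], as are the tubes of
   a path. Applying [sigma_1, ..., sigma_n] in this order returns to the linear
   Coxeter element; it shifts an interval down by one, and sends an interval
   [1, b] to [-alpha_b]. By induction, two positive roots are compatible exactly
   when their intervals are nested or separated by a gap, that is, when they are
   weakly compatible as tubes, and a cluster consists of a nested set of
   intervals together with some [-alpha_i] with [i] outside of all of them.
   A point of a cluster cone is a positive minus a negative part with disjoint
   supports. In the intersection of a cluster cone with the opposite of another
   one, the positive part for the first cone is therefore the negative part for
   the second, which restricts it to the face spanned by the intervals of the
   first cluster that only meet indices [i] with [-alpha_i] in the second, and
   conversely. The two sets of intervals obtained are the two halves of a tubing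
   of the double path, and every tubing arises in this way. *)

Set Implicit Arguments.
Unset Strict Implicit.
Unset Printing Implicit Defensive.

Import Order.TTheory GRing.Theory Num.Theory.

Local Open Scope classical_set_scope.
Local Open Scope ring_scope.

(** * Cones *)

Section Cones.
Variables (R : realType) (V : lmodType R).
Implicit Types A B : set V.

(** [cone] allows one coefficient per vector, so the coefficients of repeated vectors are added up
    over the duplicate-free list. *)
Lemma cone_pairs A (s : seq (R * V)) :
  (forall c, c \in s -> 0 <= c.1 /\ A c.2) -> cone A (\sum_(c <- s) c.1 *: c.2).
Proof.
move=> sA; exists (undup (map snd s)), (fun v => \sum_(c <- s | c.2 == v) c.1).
split=> [v | ].
  rewrite mem_undup => /mapP[c cs ->]; split; first by case: (sA c cs).
  by rewrite big_seq_cond sumr_ge0 // => d /andP[/sA[]].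
under [RHS]eq_bigr do rewrite scaler_suml.
rewrite (exchange_big_dep xpredT) //= big_seq [RHS]big_seq.
apply: eq_bigr => c cs.
under eq_bigl do rewrite eq_sym.
rewrite -big_filter filter_pred1_uniq ?undup_uniq ?mem_undup ?map_f //.
by rewrite big_seq1.
Qed.

(** With pairs a vector may carry several coefficients, so that adding combinations is concatenating
    lists. *)
Lemma coneP A x : cone A x <->
  exists2 s : seq (R * V), (forall c, c \in s -> 0 <= c.1 /\ A c.2) &
    x = \sum_(c <- s) c.1 *: c.2.
Proof.
split=> [[s [a [sA ->]]]|[s sA ->]]; last exact: cone_pairs.
exists [seq (a v, v) | v <- s]; last by rewrite big_map.
by move=> _ /mapP[v /sA[Av av0] ->].
Qed.

Definition convex_cone A :=
  A 0 /\ forall a x y, 0 <= a -> A x -> A y -> A (a *: x + y).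

Lemma convex_cone_cone A : convex_cone (cone A).
Proof.
split; first by apply/coneP; exists [::]; rewrite ?big_nil.
move=> a x y a0 /coneP[s sA ->] /coneP[t tA ->]; apply/coneP.
exists ([seq (a * c.1, c.2) | c <- s] ++ t) => [c|].
  rewrite mem_cat => /orP[/mapP[d /sA[d0 Ad] ->]|/tA //].
  by rewrite mulr_ge0.
rewrite big_cat big_map scaler_sumr; congr (_ + _).
by apply: eq_bigr => c _; rewrite scalerA.
Qed.

Lemma cone_gen A : A `<=` cone A.
Proof.
move=> x Ax; apply/coneP; exists [:: (1, x)]; last by rewrite big_seq1 scale1r.
by move=> c; rewrite inE => /eqP ->.
Qed.

Lemma cone_min A B : convex_cone B -> A `<=` B -> cone A `<=` B.
Proof.
move=> [B0 Bc] AB x /coneP[s sA ->]; elim: s sA => [|c s IHs] sA.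
  by rewrite big_nil.
rewrite big_cons; have [c0 Ac] := sA c (mem_head _ _).
apply: Bc => //; first exact: AB.
by apply: IHs => d ds; apply: sA; rewrite inE ds orbT.
Qed.

Lemma sub_cone A B : A `<=` B -> cone A `<=` cone B.
Proof.
by move=> AB; apply: cone_min; [exact: convex_cone_cone|move=> x /AB/cone_gen].
Qed.

Lemma convex_cone_add A x y : convex_cone A -> A x -> A y -> A (x + y).
Proof. by move=> [_ Ac] Ax Ay; rewrite -[x]scale1r; apply: Ac. Qed.

Lemma convex_coneI A B : convex_cone A -> convex_cone B ->
  convex_cone (A `&` B).
Proof.
move=> [A0 Ac] [B0 Bc]; split=> // a x y a0 [Ax Bx] [Ay By].
by split; [exact: Ac|exact: Bc].
Qed.

Lemma convex_coneN A : convex_cone A -> convex_cone (-%R @` A).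
Proof.
move=> [A0 Ac]; split=> [|a _ _ a0 [x Ax <-] [y Ay <-]].
  by exists 0; rewrite ?oppr0.
by exists (a *: x + y); [exact: Ac|rewrite opprD scalerN].
Qed.

Lemma cone_setU A B x : cone (A `|` B) x ->
  exists y z, [/\ cone A y, cone B z & x = y + z].
Proof.
move: x; apply: cone_min => [|x [Ax|Bx]].
- have [A0 Ac] := convex_cone_cone A; have [B0 Bc] := convex_cone_cone B.
  split; first by exists 0, 0; rewrite addr0.
  move=> a x x' a0 [y [z [yA zB ->]]] [y' [z' [yA' zB' ->]]].
  exists (a *: y + y'), (a *: z + z'); split; [exact: Ac|exact: Bc|].
  by rewrite scalerDr addrACA.
- exists x, 0; rewrite addr0; split=> //; first exact: cone_gen.
  by case: (convex_cone_cone B).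
- exists 0, x; rewrite add0r; split=> //; last exact: cone_gen.
  by case: (convex_cone_cone A).
Qed.

Lemma cone_ge0 A (f : {linear V -> R^o}) x :
  (forall v, A v -> 0 <= f v) -> cone A x -> 0 <= f x.
Proof.
move=> fA; apply: (@cone_min A (fun x => 0 <= f x)) => //.
split=> [|a y z a0 fy fz]; first by rewrite linear0.
by rewrite linearP addr_ge0 // mulr_ge0.
Qed.

(** On a combination each functional is a sum of nonnegative terms. If the sum vanishes, so does
    every term, hence all generators with a nonzero coefficient lie in the kernel. *)
Lemma cone_face (I : Type) A (M : set I) (f : I -> {linear V -> R^o}) x :
  (forall i v, A v -> 0 <= f i v) -> cone A x -> (forall i, M i -> f i x = 0) ->
  cone [set v | A v /\ forall i, M i -> f i v = 0] x.
Proof.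
move=> fA /coneP[s sA ->] fx0; apply/coneP.
exists [seq c <- s | c.1 != 0] => [c|].
  rewrite mem_filter => /andP[c0 cs]; have [c_ge0 Ac] := sA c cs.
  split=> //; split=> // i Mi; have /eqP := fx0 i Mi; rewrite linear_sum big_seq.
  rewrite psumr_eq0 => [|d /sA[d0 Ad]]; last first.
    by rewrite linearZ; apply: mulr_ge0 => //; apply: fA.
  move=> /allP/(_ _ cs)/implyP/(_ cs); rewrite linearZ mulf_eq0 (negPf c0).
  by move/eqP.
rewrite big_filter [RHS]big_mkcond; apply: eq_bigr => c _.
by case: eqP => //= ->; rewrite scale0r.
Qed.

End Cones.

Lemma image_cone (R : realType) (V W : lmodType R) (f : {linear V -> W})
  (A : set V) : f @` cone A = cone (f @` A).
Proof.
apply/seteqP; split=> [_ [x Ax <-]|].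
  move: x Ax; apply: (@cone_min _ _ A (fun x => cone (f @` A) (f x))).
    have [c0 cc] := convex_cone_cone (f @` A).
    by split=> [|a x y a0 fx fy]; rewrite ?linear0 ?linearP //; apply: cc.
  by move=> x Ax; apply: cone_gen; exists x.
apply: cone_min => [|_ [x Ax <-]]; last by exists x => //; apply: cone_gen.
have [c0 cc] := convex_cone_cone A.
split=> [|a _ _ a0 [x Ax <-] [y Ay <-]]; first by exists 0; rewrite ?linear0.
by exists (a *: x + y); [exact: cc|rewrite linearP].
Qed.

(** * Coxeter words *)

Section WordsInSimpleReflections.
Variable n : nat.
Implicit Types (i : 'I_n) (w : seq 'I_n).

(** The values exchanged by [simple_refl j] are [j] and [j.+1], and the cut after [i] separates them
    only if [j = i]. *)
Lemma simple_refl_leq i j (x : 'I_n.+1) : j != i ->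
  (simple_refl j x <= i)%N = (x <= i)%N.
Proof.
rewrite /simple_refl -val_eqE /=; case: tpermP => [->|->|//] /=; rewrite /bump /=; lia.
Qed.

Lemma word_perm_leq i w (x : 'I_n.+1) : i \notin w ->
  (word_perm w x <= i)%N = (x <= i)%N.
Proof.
rewrite /word_perm; elim: w x => [|j w IHw] x; first by rewrite big_nil perm1.
rewrite inE negb_or eq_sym big_cons permM => /andP[ji iw].
by rewrite IHw // simple_refl_leq.
Qed.

(** Some point crosses the cut after [i] under [word_perm w], which takes a letter [i] in any word
    for this permutation. *)
Lemma mem_word_perm i w w' : uniq w -> i \in w ->
  word_perm w' = word_perm w -> i \in w'.
Proof.
move=> w_uniq iw ww'; apply/negPn/negP => iNw'.
case/splitPr: iw w_uniq ww' => u v; rewrite -cat_rcons cat_uniq rcons_uniq.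
rewrite has_sym has_rcons negb_or => /and3P[/andP[iu _] /andP[iv _] _] ww'.
(* The point [x] reaches [i] just before the only letter [i] of [w]; this letter moves it across the
   cut, and the letters of [v] cannot bring it back. *)
pose x := ((word_perm u)^-1)%g (ord_lo i).
have := word_perm_leq x iNw'; rewrite ww' /word_perm big_cat big_rcons /=.
rewrite -/(word_perm u) -/(word_perm v) !permM permKV /simple_refl tpermL.
rewrite word_perm_leq // -(word_perm_leq x iu) permKV /= /bump; lia.
Qed.

Lemma reduced_coxeter_word w : perm_eq w (enum 'I_n) ->
  reduced_word w (word_perm w).
Proof.
move=> w_enum; split=> // w' ww'; rewrite (perm_size w_enum).
apply: uniq_leq_size => [|i _]; first exact: enum_uniq.
by apply: (@mem_word_perm i w) => //;
  rewrite ?(perm_uniq w_enum) ?(perm_mem w_enum) ?enum_uniq ?mem_enum.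
Qed.

Lemma word_perm_conj i w :
  (simple_refl i * word_perm (i :: w) * simple_refl i)%g = word_perm (rcons w i).
Proof. by rewrite /word_perm big_cons big_rcons /= mulgA tperm2 mul1g. Qed.

(** The letter [i] is first in the rotation by [i] and last in the next one, so conjugating by the
    successive letters runs through the rotations and returns to the linear Coxeter element. *)
Lemma rot_enum_ord i : exists w,
  rot i (enum 'I_n) = i :: w /\ rot i.+1 (enum 'I_n) = rcons w i.
Proof.
have i_enum : (i < size (enum 'I_n))%N by rewrite size_enum_ord.
exists (drop i.+1 (enum 'I_n) ++ take i (enum 'I_n)); split.
  by rewrite /rot (drop_nth i) // nth_ord_enum.
by rewrite /rot (take_nth i) // nth_ord_enum rcons_cat.
Qed.

Lemma coxeter_rot (k : nat) : coxeter_element (word_perm (rot k (enum 'I_n))).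
Proof. by exists (rot k (enum 'I_n)); rewrite perm_rot. Qed.

Lemma initial_rot i : initial i (word_perm (rot i (enum 'I_n))).
Proof.
have [w [wi _]] := rot_enum_ord i; exists w; rewrite wi.
by apply: reduced_coxeter_word; rewrite -wi perm_rot.
Qed.

Lemma conj_rot i :
  (simple_refl i * word_perm (rot i (enum 'I_n)) * simple_refl i)%g =
  word_perm (rot i.+1 (enum 'I_n)).
Proof. by have [w [-> ->]] := rot_enum_ord i; apply: word_perm_conj. Qed.

End WordsInSimpleReflections.

(** * Intervals and roots *)

Section Intervals.
Variables (R : realType) (n : nat).
Local Notation E := 'rV[R]_n.+1.
Implicit Types (p q : nat * nat) (P : set (nat * nat)) (N : set 'I_n).

(** Half-open and counted from 0: [(a, b)] stands for the indices [a], ..., [b.-1], so that its ends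
    are also those of the root [pair_root (a, b)]. *)
Definition is_interval p := (p.1 < p.2 <= n)%N.

Definition in_interval p (i : nat) := (p.1 <= i < p.2)%N.

Definition subinterval p q := (q.1 <= p.1)%N && (p.2 <= q.2)%N.

(** The strict inequalities leave an index between the two half-open intervals. *)
Definition path_compatible p q :=
  [|| subinterval p q, subinterval q p, (p.2 < q.1)%N | (q.2 < p.1)%N].

Definition interval_vec p : 'rV[R]_n := \row_(i < n) (in_interval p i)%:R.

(* The root [epsilon_(p.1 + 1) - epsilon_(p.2 + 1)], negative when
   [p.2 < p.1]; [inord] makes it meaningless if an entry exceeds [n]. *)
Definition pair_root p : E := delta_mx 0 (inord p.1) - delta_mx 0 (inord p.2).

Lemma pair_rootE p :
  pair_root p = delta_mx 0 (inord p.1) - delta_mx 0 (inord p.2).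
Proof. by []. Qed.

Lemma identification_is_linear : linear (@identification R n).
Proof.
move=> a x y; rewrite /identification scaler_sumr -big_split.
by apply: eq_bigr => i _; rewrite !mxE scalerDl scalerA.
Qed.

HB.instance Definition _ := GRing.isLinear.Build R 'rV[R]_n E _
  (@identification R n) identification_is_linear.

(** On combinations of simple roots this is the coefficient of [simple_root i]; [R^o] is [R] as a
    module over itself. *)
Definition prefix_sum (i : 'I_n) (x : E) : R^o := \sum_(k < n.+1 | (k <= i)%N) x 0 k.

Lemma prefix_sum_is_linear i : linear (prefix_sum i).
Proof.
move=> a x y; rewrite /prefix_sum scaler_sumr -big_split.
by apply: eq_bigr => k _; rewrite !mxE.
Qed.

HB.instance Definition _ i := GRing.isLinear.Build R E R^o _
  (prefix_sum i) (prefix_sum_is_linear i).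

Lemma prefix_sum_delta i k : prefix_sum i (delta_mx 0 k) = (k <= i)%:R.
Proof.
rewrite /prefix_sum big_mkcond (bigD1 k) //= big1 => [|j /negPf jk].
  by rewrite mxE !eqxx addr0; case: leqP.
by rewrite mxE jk andbF if_same.
Qed.

Lemma prefix_sum_root i p : (p.1 <= n)%N -> (p.2 <= n)%N ->
  prefix_sum i (pair_root p) = (p.1 <= i)%:R - (p.2 <= i)%:R.
Proof. by move=> p1 p2; rewrite linearB /= !prefix_sum_delta !inordK. Qed.

Lemma simple_rootE (i : 'I_n) : simple_root R i = pair_root (i : nat, i.+1).
Proof.
rewrite /simple_root /pair_root; congr (delta_mx _ _ - delta_mx _ _);
  by apply: val_inj; rewrite /= inordK ?ltnS // ltnW.
Qed.

Lemma opp_simple_rootE (i : 'I_n) : - simple_root R i = pair_root (i.+1, i : nat).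
Proof. by rewrite simple_rootE opprB. Qed.

Lemma prefix_sum_simple_root (i j : 'I_n) :
  prefix_sum i (simple_root R j) = (i == j)%:R.
Proof.
have j_n : (j <= n)%N := ltnW (ltn_ord j).
rewrite simple_rootE prefix_sum_root //= eq_sym -val_eqE /=.
by case: (ltngtP j i) => ?; rewrite ?subrr ?subr0.
Qed.

Lemma prefix_sum_identification i x : prefix_sum i (identification x) = x 0 i.
Proof.
rewrite /identification linear_sum (bigD1 i) //= big1 => [|j /negPf ij].
  by rewrite linearZ /= prefix_sum_simple_root eqxx addr0 [LHS]mulr1.
by rewrite linearZ /= prefix_sum_simple_root eq_sym ij [LHS]mulr0.
Qed.

Lemma identification_inj : injective (@identification R n).
Proof.
move=> x y xy; apply/rowP => i.
by rewrite -!prefix_sum_identification xy.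
Qed.

(** The functionals [prefix_sum i] are dual to the simple roots. *)
Lemma free_simple_root : free [tuple simple_root R j | j < n].
Proof.
apply/freeP => k k0 i.
have /(congr1 (prefix_sum i)) : identification (\row_j k j) = 0.
  rewrite -k0; apply: eq_bigr => j _; rewrite mxE; congr (_ *: _).
  by rewrite (nth_map j) ?size_enum_ord // nth_ord_enum.
by rewrite prefix_sum_identification mxE linear0.
Qed.

Lemma root_coef_identification (x : 'rV[R]_n) i : root_coef (identification x) i = x 0 i.
Proof.
rewrite -(coord_sum_free (fun j => x 0 j) i free_simple_root).
congr (coord _ _ _); apply: eq_bigr => j _; congr (_ *: _).
by rewrite (nth_map j) ?size_enum_ord // nth_ord_enum.
Qed.

Lemma identification_interval p : is_interval p ->
  identification (interval_vec p) = pair_root p.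
Proof.
move=> /andP[p12 p2]; rewrite /identification.
transitivity (\sum_(p.1 <= k < p.2) pair_root (k, k.+1)).
  rewrite (big_nat_widen _ _ n) // big_geq_mkord [RHS]big_mkcond.
  apply: eq_bigr => i _; rewrite mxE simple_rootE /in_interval andbC /=.
  by case: andP; rewrite ?scale1r ?scale0r.
rewrite -[RHS]opprB -(@telescope_sumr _ _ _ (fun k => delta_mx 0 (inord k))) 1?ltnW //.
by rewrite -sumrN; apply: eq_bigr => k _; rewrite opprB.
Qed.

Lemma identification_delta (i : 'I_n) :
  identification (delta_mx 0 i) = simple_root R i.
Proof.
rewrite /identification (bigD1 i) //= mxE !eqxx scale1r big1 ?addr0 // => j ji.
by rewrite mxE (negPf ji) andbF scale0r.
Qed.

(** It is enough to compare the entries at [inord a] and [inord b], which are 1 and -1 on the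
    left. *)
Lemma pair_root_inj p q : (p.1 <= n)%N -> (p.2 <= n)%N -> p.1 <> p.2 ->
  (q.1 <= n)%N -> (q.2 <= n)%N -> q.1 <> q.2 ->
  pair_root p = pair_root q -> p = q.
Proof.
case: p q => [a b] [c d] /= an bn ab cn dn cd /rowP e.
have eqi k l : (k <= n)%N -> (l <= n)%N ->
    ((inord k : 'I_n.+1) == inord l) = (k == l).
  by move=> kn ln; rewrite -val_eqE /= !inordK.
have /eqP := e (inord a); have /eqP := e (inord b); rewrite !mxE !eqi // !eqxx /=.
rewrite (introF eqP ab) [b == a]eq_sym (introF eqP ab) sub0r subr0.
have nz : (1 == -1 :> R) = false by rewrite -addr_eq0 (pnatr_eq0 R 2).
have nz' : (-1 == 1 :> R) = false by rewrite eq_sym nz.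
by case: (b =P c) => bc; case: (b =P d) => bd; case: (a =P c) => ac;
  case: (a =P d) => ad //=; rewrite ?subrr ?sub0r ?subr0 ?eqr_opp ?oppr_eq0
    ?nz ?nz' ?oner_eq0 //; congruence.
Qed.

Lemma root_pair (x : E) : Defs.root x <->
  exists p, [/\ (p.1 <= n)%N, (p.2 <= n)%N, p.1 <> p.2 & x = pair_root p].
Proof.
split=> [[i [j [ij ->]]]|[[a b] /= [an bn ab ->]]].
  exists (i : nat, j : nat); rewrite /pair_root /= !inord_val.
  by split=> //; [exact: (ltn_ord i)|exact: (ltn_ord j)|apply/eqP].
exists (inord a), (inord b); split=> //.
by rewrite -val_eqE /= !inordK //; apply/eqP.
Qed.

(** For distinct ends, [p.1 <= p.2.+1] means either [p.1 < p.2], a positive root, or [p.1 = p.2.+1],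
    the opposite of a simple root. *)
Lemma almost_positive_pair (x : E) : almost_positive_root x <->
  exists p, [/\ (p.1 <= n)%N, (p.2 <= n)%N, p.1 <> p.2, (p.1 <= p.2.+1)%N &
                x = pair_root p].
Proof.
split=> [[/root_pair[p [p1 p2 p12 ->]] [pos|[i]]]|[p [p1 p2 p12 p12' ->]]].
- exists p; split=> //; rewrite leqNgt; apply/negP => p21.
  have p2n : (p.2 < n)%N by lia.
  (* The coefficient of the simple root of index [p.2] is -1, against the positivity of the root. *)
  have : 0 <= prefix_sum (Ordinal p2n) (pair_root p).
    apply: cone_ge0 pos => _ [j _ <-].
    by rewrite [leRHS]prefix_sum_simple_root.
  rewrite prefix_sum_root //= leqnn leqNgt (ltnW p21) /= sub0r oppr_ge0.
  by rewrite ler10.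
- have i_n := ltn_ord i; rewrite opp_simple_rootE => /pair_root_inj-> //=.
  + by exists (i.+1, i : nat); split=> //=; lia.
  + exact: ltnW.
  + lia.
- split; first by apply/root_pair; exists p.
  case: (ltnP p.1 p.2) => [lt12|le21]; [left|right].
    rewrite -identification_interval /is_interval ?lt12 //.
    apply/coneP; exists [seq (interval_vec p 0 i, simple_root R i) | i <- enum 'I_n].
      move=> _ /mapP[i _ ->]; split; last by exists i.
      by rewrite mxE ler0n.
    by rewrite big_map enumT.
  have p2n : (p.2 < n)%N by lia.
  exists (Ordinal p2n); rewrite opp_simple_rootE; congr pair_root => /=.
  by case: p p1 p2 p12 p12' le21 p2n => a b /= *; congr (_, _); lia.
Qed.

End Intervals.

(** * Linear compatibility *)

Section LinearCompatibility.
Variables (R : realType) (n : nat).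
Local Notation E := 'rV[R]_n.+1.
Local Notation pair_root := (@pair_root R n).
Implicit Types (p q : nat * nat) (i : 'I_n).

Definition swap_succ (i x : nat) : nat :=
  if x == i then i.+1 else if x == i.+1 then i else x.

(** The first branch is for the roots [-alpha_j] with [j] different from [i], which are fixed; here
    [j] is [p.2]. *)
Definition sigma_pair (i : nat) p :=
  if (p.1 == p.2.+1) && (p.2 != i) then p
  else (swap_succ i p.1, swap_succ i p.2).

Lemma simple_refl_inord i (x : nat) : (x <= n)%N ->
  simple_refl i (inord x) = inord (swap_succ i x).
Proof.
move=> xn; have hi : ord_hi i = inord i.+1.
  by apply: val_inj; rewrite /= inordK ?ltnS.
have lo : ord_lo i = inord i by apply: val_inj; rewrite /= inordK ?ltnS // ltnW.
have eqi k l : (k <= n)%N -> (l <= n)%N ->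
    ((inord k : 'I_n.+1) == inord l) = (k == l).
  by move=> kn ln; rewrite -val_eqE /= !inordK.
rewrite /simple_refl permE /= lo hi !eqi //; last exact: ltnW.
by rewrite /swap_succ; case: eqP => // _; case: eqP.
Qed.

(** [col_perm] moves basis vectors by the inverse permutation, and a transposition is its own
    inverse. *)
Lemma col_perm_delta i (k : 'I_n.+1) :
  col_perm (simple_refl i) (delta_mx 0 k) = delta_mx 0 (simple_refl i k) :> E.
Proof.
apply/rowP => j; rewrite !mxE.
by rewrite -(inj_eq (@perm_inj _ (simple_refl i)) j) /simple_refl tpermK.
Qed.

Lemma sigma_pair_root i p : (p.1 <= n)%N -> (p.2 <= n)%N -> p.1 <> p.2 ->
  sigma i (pair_root p) = pair_root (sigma_pair i p).
Proof.
move=> p1 p2 p12; rewrite /sigma /sigma_pair.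
have -> : [exists j, (j != i) && (pair_root p == - simple_root R j)] =
          (p.1 == p.2.+1) && (p.2 != i).
  apply/existsP/idP => [[j /andP[ji /eqP]]|/andP[/eqP p12' pi]].
    rewrite opp_simple_rootE => /pair_root_inj-> //=.
    - by rewrite eqxx val_eqE.
    - exact: ltnW.
    - lia.
  have p2n : (p.2 < n)%N by lia.
  exists (Ordinal p2n); rewrite -val_eqE /= pi opp_simple_rootE /=.
  by rewrite -p12'; case: p {p1 p2 p12 p12' pi p2n}.
case: ifP => // _; rewrite !pair_rootE linearB /= !col_perm_delta.
by rewrite !simple_refl_inord.
Qed.

(* [shift_end k] is the composite of [simple_refl 0], ..., [simple_refl k.-1],
   applied in this order, and [rotate k] that of the corresponding [sigma]'s on
   the endpoints of a positive root. *)
Definition shift_end (k x : nat) : nat :=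
  if x == 0 then k else if (x <= k)%N then x.-1 else x.

Definition rotate (k : nat) p :=
  if (p.1 == 0%N) && (p.2 <= k)%N then (p.2, p.2.-1)
  else (shift_end k p.1, shift_end k p.2).

Lemma rotate0 p : is_interval n p -> rotate 0 p = p.
Proof.
case: p => a b; rewrite /rotate /shift_end /is_interval /= => ab.
repeat case: ifP => /=; move=> *; congr (_, _); lia.
Qed.

(** After [k] steps the interval [(0, k.+1)] is the simple root [(k, k.+1)]; the next step turns it
    into [(k.+1, k)], which every later step fixes. *)
Lemma sigma_rotate k p : is_interval n p -> (k < n)%N ->
  sigma_pair k (rotate k p) = rotate k.+1 p.
Proof.
case: p => a b; rewrite /sigma_pair /rotate /shift_end /swap_succ /is_interval.
move=> /= ab kn.
by repeat case: ifP => /=; move=> *; try lia; congr (_, _); lia.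
Qed.

Lemma rotate_bounds k p (r := rotate k p) : is_interval n p -> (k <= n)%N ->
  [/\ (r.1 <= n)%N, (r.2 <= n)%N, r.1 <> r.2 & (r.1 <= r.2.+1)%N].
Proof.
rewrite {}/r; case: p => a b; rewrite /rotate /shift_end /is_interval /= => ab kn.
by split; repeat case: ifP => /=; move=> *; lia.
Qed.

Lemma rotate_n p : is_interval n p ->
  rotate n p = if p.1 == 0 then (p.2, p.2.-1) else (p.1.-1, p.2.-1).
Proof.
case: p => a b; rewrite /rotate /shift_end /is_interval /= => ab.
by repeat case: ifP => /=; move=> *; try lia; congr (_, _); lia.
Qed.

Variable compat : 'S_n.+1 -> E -> E -> Prop.
Hypothesis hcompat : compatibility_family compat.
Local Notation c := (linear_coxeter n).

Lemma coxeter_linear : coxeter_element c.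
Proof. by have := coxeter_rot n 0; rewrite rot0. Qed.

Lemma almost_positive_interval p : is_interval n p ->
  almost_positive_root (pair_root p).
Proof.
move=> /andP[p12 p2]; apply/almost_positive_pair; exists p; split=> //; lia.
Qed.

Lemma almost_positive_opp_simple i : almost_positive_root (- simple_root R i).
Proof.
apply/almost_positive_pair; exists (i.+1, i : nat); rewrite opp_simple_rootE.
by split=> //=; rewrite ?(ltnW (ltn_ord i)) //; lia.
Qed.

(** The recursive condition is applied at each letter in turn, each being initial in the current
    rotation. *)
Lemma compat_rotate k p q : is_interval n p -> is_interval n q -> (k <= n)%N ->
  compat c (pair_root p) (pair_root q) <->
  compat (word_perm (rot k (enum 'I_n)))
    (pair_root (rotate k p)) (pair_root (rotate k q)).
Proof.
move=> Ip Iq; elim: k => [|k IHk] kn; first by rewrite !rotate0 ?rot0.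
case: hcompat => _ _ /(_ _ (Ordinal kn)) step.
have [p1 p2 p12 p12'] := rotate_bounds Ip (ltnW kn).
have [q1 q2 q12 q12'] := rotate_bounds Iq (ltnW kn).
rewrite IHk 1?ltnW // (step _ _ _ (coxeter_rot n k) (initial_rot (Ordinal kn))).
- by rewrite !sigma_pair_root //= !sigma_rotate // (conj_rot (Ordinal kn)).
- by apply/almost_positive_pair; exists (rotate k p).
- by apply/almost_positive_pair; exists (rotate k q).
Qed.

Lemma interval_neq_opp_simple p i : is_interval n p ->
  pair_root p <> - simple_root R i.
Proof.
move=> /andP[p12 p2]; rewrite opp_simple_rootE => /pair_root_inj pi.
have i_n := ltn_ord i.
suff e : p = (i.+1, i : nat) by move: p12; rewrite e /=; lia.
by apply: pi => //=; lia.
Qed.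

(** The coefficients of an interval root are 0 or 1, and the condition on negative simple roots
    reads off the one at [i]. *)
Lemma compat_opp_simple_interval i p : is_interval n p ->
  compat c (- simple_root R i) (pair_root p) <-> ~~ in_interval p i.
Proof.
move=> Ip; case: hcompat => _ neg _; rewrite neg.
- rewrite -identification_interval // root_coef_identification mxE.
  by case: in_interval; split=> // /eqP; rewrite oner_eq0.
- exact: coxeter_linear.
- exact: almost_positive_interval.
- exact: interval_neq_opp_simple.
Qed.

Lemma compat_opp_simple i j : i != j ->
  compat c (- simple_root R i) (- simple_root R j).
Proof.
move=> ij; case: hcompat => _ neg _; apply/neg.
- exact: coxeter_linear.
- exact: almost_positive_opp_simple.
- move/oppr_inj; rewrite -!identification_delta => /identification_inj/rowP/(_ i).
  by rewrite !mxE !eqxx (negPf ij) /= => /eqP; rewrite eq_sym oner_eq0.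
- rewrite -identification_delta -linearN root_coef_identification !mxE.
  by rewrite (negPf ij) andbF oppr0.
Qed.

Lemma compat_sym_interval p q : is_interval n p -> is_interval n q ->
  compat c (pair_root p) (pair_root q) -> compat c (pair_root q) (pair_root p).
Proof.
move=> Ip Iq; case: hcompat => sym _ _; apply: sym; first exact: coxeter_linear.
  exact: almost_positive_interval.
exact: almost_positive_interval.
Qed.

(** A full turn makes [p] the opposite of the simple root of index [p.2.-1]. If [q] starts at 0 too,
    it also becomes such an opposite, and the two intervals are nested. Otherwise [q] shifts down,
    and [p.2.-1] is outside of it exactly when [q] was inside [p] or beyond a gap. *)
Lemma compat_initial_interval p q : is_interval n p -> is_interval n q -> p <> q ->
  p.1 = 0 ->
  compat c (pair_root p) (pair_root q) <-> path_compatible p q.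
Proof.
move=> Ip Iq pq p0; rewrite (compat_rotate Ip Iq (leqnn n)).
rewrite rot_oversize ?size_enum_ord // !rotate_n // p0 eqxx.
have p2n : (p.2.-1 < n)%N by move: Ip; rewrite /is_interval; lia.
have -> : pair_root (p.2, p.2.-1) = - simple_root R (Ordinal p2n).
  by rewrite opp_simple_rootE /= prednK //; move: Ip; rewrite /is_interval; lia.
case: eqP => [q0|/eqP q0].
  have q2n : (q.2.-1 < n)%N by move: Iq; rewrite /is_interval; lia.
  have -> : pair_root (q.2, q.2.-1) = - simple_root R (Ordinal q2n).
    by rewrite opp_simple_rootE /= prednK //; move: Iq; rewrite /is_interval; lia.
  split=> _; first by rewrite /path_compatible /subinterval p0 q0; lia.
  apply: compat_opp_simple; rewrite -val_eqE /=; apply/eqP => pq2; apply: pq.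
  move: p q p0 q0 pq2 Ip Iq {p2n q2n} => [a b] [e d] /= -> -> bd.
  by rewrite /is_interval /= => ? ?; congr (_, _); lia.
rewrite compat_opp_simple_interval; last first.
  by move: Iq; rewrite /is_interval /=; lia.
move: Ip Iq; rewrite /is_interval /in_interval /path_compatible /subinterval /=.
by move=> *; split=> ?; lia.
Qed.

(** Induction on [p.1]: full turns translate both intervals down, which preserves nesting and gaps,
    until one of them starts at 0. Symmetry covers the case where it is [q]. *)
Lemma compat_interval p q : is_interval n p -> is_interval n q -> p <> q ->
  compat c (pair_root p) (pair_root q) <-> path_compatible p q.
Proof.
have [m] := ubnP p.1; elim: m p q => // m IHm p q pm Ip Iq pq.
have [p0|p0] := eqVneq p.1 0; first exact: compat_initial_interval.
have [q0|q0] := eqVneq q.1 0.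
  have -> : path_compatible p q = path_compatible q p.
    by rewrite /path_compatible orbCA; congr [|| _, _ | _]; rewrite orbC.
  rewrite -compat_initial_interval //; last exact: nesym.
  by split; apply: compat_sym_interval.
rewrite (compat_rotate Ip Iq (leqnn n)) rot_oversize ?size_enum_ord //.
rewrite !rotate_n // (negPf p0) (negPf q0) -/c.
move: Ip Iq; rewrite /is_interval => Ip Iq.
rewrite IHm /is_interval /path_compatible /subinterval /=; try lia.
move=> [pq1 pq2]; apply: pq; move: p q pq1 pq2 p0 q0 Ip Iq {pm} => [a b] [e d] /=.
by move=> *; congr (_, _); lia.
Qed.

End LinearCompatibility.

(** * Intersections of cluster cones *)

Section ClusterData.
Variables (R : realType) (n : nat).
Local Notation E := 'rV[R]_n.+1.
Local Notation interval_vec := (@interval_vec R n).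
Local Notation pair_root := (@pair_root R n).
Implicit Types (p q : nat * nat) (P : set (nat * nat)) (N : set 'I_n).

(** [P] gives the positive roots of a compatible set as intervals and [N] its negative simple roots
    by index; distinct elements of [N] are always compatible, by [compat_opp_simple]. *)
Definition cluster_data P N :=
  [/\ forall p, P p -> is_interval n p,
      forall p q, P p -> P q -> path_compatible p q &
      forall p (i : 'I_n), P p -> N i -> ~~ in_interval p i].

Definition cluster_gens P N : set 'rV[R]_n :=
  interval_vec @` P `|` [set - delta_mx 0 i | i in N].

Lemma image_cluster_gens P N : (forall p, P p -> is_interval n p) ->
  (@identification R n) @` cluster_gens P N =
  pair_root @` P `|` [set - simple_root R i | i in N].
Proof.
move=> PI; rewrite /cluster_gens image_setU !image_comp; congr (_ `|` _).
  by apply: eq_imagel => p /PI; apply: identification_interval.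
by apply: eq_imagel => i _ /=; rewrite linearN /= identification_delta.
Qed.

Lemma cluster_fan_linear (compat : 'S_n.+1 -> E -> E -> Prop) :
  compatibility_family compat ->
  cluster_fan (compat (linear_coxeter n)) =
  [set C | exists P N, cluster_data P N /\
     C = (@identification R n) @` cone (cluster_gens P N)].
Proof.
move=> hcompat; apply/seteqP; split=> [_ [B [Bpos Bcompat] <-]|].
  pose P := [set p | is_interval n p /\ B (pair_root p)].
  pose N := [set i : 'I_n | B (- simple_root R i)].
  exists P, N; split.
    split=> [p []//|p q [Ip Bp] [Iq Bq]|p i [Ip Bp] Ni].
      (* [Bcompat] only concerns distinct roots. *)
      have [<-|/eqP pq] := eqVneq p q.
        by rewrite /path_compatible /subinterval !leqnn.
      apply/(compat_interval hcompat Ip Iq pq)/Bcompat => // e; apply: pq.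
      move: Ip Iq => /andP[p12 p2] /andP[q12 q2].
      by apply: pair_root_inj e => //; lia.
    apply/(compat_opp_simple_interval hcompat i Ip)/Bcompat => //.
    exact/nesym/interval_neq_opp_simple.
  rewrite image_cone image_cluster_gens => [|p []//]; congr cone.
  apply/seteqP; split=> [b Bb|_ [[p [_ Bp] <-]//|[i Ni <-]//]].
  have /almost_positive_pair[[a d] /= [an dn ad ad' eb]] := Bpos _ Bb.
  have [lt_ad|le_da] := ltnP a d.
    by left; exists (a, d); rewrite ?eb //; split; rewrite -?eb //; apply/andP.
  have dn' : (d < n)%N by lia.
  have e : - simple_root R (Ordinal dn') = b.
    by rewrite eb opp_simple_rootE; congr (pair_root (_, _)) => /=; lia.
  by right; exists (Ordinal dn'); rewrite /N /= ?e.
move=> _ [P [N [[PI PP PN] ->]]]; rewrite image_cone image_cluster_gens //.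
exists (pair_root @` P `|` [set - simple_root R i | i in N]) => //; split.
  move=> _ [[p /PI Ip <-]|[i _ <-]]; first exact: almost_positive_interval.
  exact: almost_positive_opp_simple.
move=> _ _ [[p Pp <-]|[i Ni <-]] [[q Pq <-]|[j Nj <-]] neq.
- apply/(compat_interval hcompat); [exact: PI|exact: PI| |exact: PP].
  by move=> pq; apply: neq; rewrite pq.
- case: (hcompat) => sym _ _; apply: sym.
  + exact: coxeter_linear.
  + exact: almost_positive_opp_simple.
  + exact/almost_positive_interval/PI.
  + by apply/(compat_opp_simple_interval hcompat); [exact: PI|exact: PN].
- by apply/(compat_opp_simple_interval hcompat); [exact: PI|exact: PN].
- apply: compat_opp_simple => //.
  by apply/eqP => ij; apply: neq; rewrite ij.
Qed.

Definition coordinate (i : 'I_n) (x : 'rV[R]_n) : R^o := x 0 i.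

Lemma coordinate_is_linear i : linear (coordinate i).
Proof. by move=> a x y; rewrite /coordinate !mxE. Qed.

HB.instance Definition _ i := GRing.isLinear.Build R 'rV[R]_n R^o _
  (coordinate i) (coordinate_is_linear i).

(** [N] is meant to come from the other cluster: its cone contains the opposites of the vectors of
    these intervals, by [cone_opp_interval]. *)
Definition supported_in P N := [set p | P p /\ forall i : 'I_n, in_interval p i -> N i].

Lemma interval_vec_sum p :
  interval_vec p = \sum_(i < n | in_interval p i) delta_mx 0 i.
Proof.
apply/rowP => j; rewrite summxE mxE big_mkcond (bigD1 j) //= big1 => [|i ij].
  by rewrite mxE !eqxx addr0; case: ifP.
by rewrite mxE eq_sym (negPf ij) andbF if_same.
Qed.

Lemma cone_opp_interval P N p : (forall i : 'I_n, in_interval p i -> N i) ->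
  cone (cluster_gens P N) (- interval_vec p).
Proof.
move=> pN; apply/coneP.
exists [seq (1, - delta_mx 0 i) |
          i <- [seq i <- enum 'I_n | in_interval p (val i)]].
  move=> c /mapP[i]; rewrite mem_filter => /andP[/pN Ni _] ->.
  by split=> //; right; exists i.
rewrite big_map big_filter big_enum_cond interval_vec_sum -sumrN.
by apply: eq_bigr => i _; rewrite scale1r.
Qed.

(** At an index of [N] no interval of [P] contributes, and elsewhere no negative generator does, so
    the two parts have disjoint supports. *)
Lemma cluster_cone_split P N x : cluster_data P N -> cone (cluster_gens P N) x ->
  exists y z, [/\ x = y + z, cone (interval_vec @` P) y,
    forall i, z 0 i <= 0 <= y 0 i, forall i, y 0 i = 0 \/ z 0 i = 0 &
    forall i, ~ N i -> z 0 i = 0].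
Proof.
move=> [PI PP PN] /cone_setU[y [z [cy cz ->]]]; exists y, z.
have z0 i : ~ N i -> z 0 i = 0.
  move=> Ni; move: z cz; apply: (@cone_min _ _ _ [set z : 'rV[R]_n | z 0 i = 0]).
    by split=> [|a u v _ /= u0 v0] /=; rewrite !mxE ?u0 ?v0 ?mulr0 ?addr0.
  move=> _ [j Nj <-] /=; rewrite !mxE eqxx; case: eqP => [e|]; rewrite ?oppr0 //.
  by case: Ni; rewrite e.
split=> // i; last first.
  have [Ni|/z0] := pselect (N i); last by right.
  left; move: y cy; apply: (@cone_min _ _ _ [set y : 'rV[R]_n | y 0 i = 0]).
    by split=> [|a u v _ /= u0 v0] /=; rewrite !mxE ?u0 ?v0 ?mulr0 ?addr0.
  by move=> _ [p Pp <-] /=; rewrite mxE (negPf (PN p i Pp Ni)).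
rewrite -oppr_ge0; apply/andP; split.
  apply: (@cone_ge0 _ _ _ (\- (coordinate i))%R z _ cz) => _ [j _ <-] /=.
  by rewrite /coordinate !mxE opprK.
apply: (@cone_ge0 _ _ _ (coordinate i) y _ cy) => _ [p _ <-].
by rewrite /= /coordinate mxE.
Qed.

(** Vanishing of the nonnegative coordinates outside [N] cuts out a face, spanned by the intervals
    that avoid these coordinates. *)
Lemma cone_supported_in P N y : cone (interval_vec @` P) y ->
  (forall i, ~ N i -> y 0 i = 0) -> cone (interval_vec @` supported_in P N) y.
Proof.
move=> cy y0.
have ge0 (i : 'I_n) v : (interval_vec @` P) v -> 0 <= coordinate i v.
  by move=> [p _ <-]; rewrite /coordinate mxE.
apply: sub_cone (@cone_face _ _ _ _ [set i | ~ N i] _ _ ge0 cy y0).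
move=> _ [[p Pp <-] p0]; exists p => //; split=> // i pi.
apply: contrapT => /p0; rewrite /= /coordinate mxE pi => /eqP.
by rewrite oner_eq0.
Qed.

(* In both cones the positive and negative parts of a point have disjoint
   supports, so they are its coordinatewise positive and negative parts; hence
   the positive part for one cone is the negative part for the other. *)
Lemma cluster_cone_setI P N P' N' : cluster_data P N -> cluster_data P' N' ->
  cone (cluster_gens P N) `&` -%R @` cone (cluster_gens P' N') =
  cone (interval_vec @` supported_in P N' `|`
        -%R @` (interval_vec @` supported_in P' N)).
Proof.
move=> dPN dPN'; apply/seteqP; split=> [x [cx [x' cx' x'x]]|].
  have [y [z [ex cy zy yz z0]]] := cluster_cone_split dPN cx.
  have [y' [z' [ex' cy' zy' yz' z0']]] := cluster_cone_split dPN' cx'.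
  have e i : y 0 i = - z' 0 i /\ z 0 i = - y' 0 i.
    have := congr1 (fun u : 'rV_n => u 0 i) x'x; rewrite ex ex' !mxE.
    move: (zy i) (zy' i) => /andP[? ?] /andP[? ?].
    by case: (yz i) => ?; case: (yz' i) => ? ?; split; lra.
  have -> : x = y + - y'.
    by rewrite ex; congr (_ + _); apply/rowP => i; rewrite mxE; case: (e i).
  apply: convex_cone_add; first exact: convex_cone_cone.
    apply: sub_cone (@subsetUl _ _ _) _ _; apply: cone_supported_in => // i /z0' zi.
    by case: (e i) => ->; rewrite zi oppr0.
  apply: sub_cone (@subsetUr _ _ _) _ _; rewrite -image_cone; exists y' => //.
  apply: cone_supported_in => // i /z0 zi; case: (e i) => _ /eqP.
  by rewrite zi eq_sym oppr_eq0 => /eqP.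
(* Conversely, a retained interval vector generates one of the cluster cones, and its opposite is a
   sum of negative generators of the other. *)
apply: cone_min => [|_ [[p [Pp pN'] <-]|[_ [p [Pp pN] <-] <-]]].
- by apply: convex_coneI; [|apply: convex_coneN]; apply: convex_cone_cone.
- split; first by apply: cone_gen; left; exists p.
  by exists (- interval_vec p); rewrite ?opprK //; apply: cone_opp_interval.
- split; first exact: cone_opp_interval.
  by exists (interval_vec p) => //; apply: cone_gen; left; exists p.
Qed.

End ClusterData.

(** * Tubings of the double path *)

Section Tubes.
Variable n : nat.
Local Notation g := (@double_path n).
Implicit Types (s : bool) (p q : nat * nat) (t : {set spm n}).

Definition signed_interval s p : {set spm n} :=
  [set x : spm n | (x.1 == s) && in_interval p x.2]%SET.

Lemma mem_signed_interval s p (x : spm n) :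
  (x \in signed_interval s p) = (x.1 == s) && in_interval p x.2.
Proof. by rewrite inE. Qed.

Lemma sub_signed_interval s p q : is_interval n p ->
  (signed_interval s p \subset signed_interval s q) = subinterval p q.
Proof.
move=> /andP[p12 p2]; apply/idP/idP => [/fintype.subsetP pq|pq].
  have p1n : (p.1 < n)%N by lia.
  have p2n : (p.2.-1 < n)%N by lia.
  have := pq (s, Ordinal p1n); have := pq (s, Ordinal p2n).
  rewrite !mem_signed_interval !eqxx /in_interval /subinterval /=; lia.
apply/fintype.subsetP => x; rewrite !mem_signed_interval /in_interval.
move: pq; rewrite /subinterval => pq /andP[->] /=; lia.
Qed.

Lemma signed_interval_inj s s' p q : is_interval n p -> is_interval n q ->
  signed_interval s p = signed_interval s' q -> s = s' /\ p = q.
Proof.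
move=> Ip Iq e; have p1n : (p.1 < n)%N by move: Ip; rewrite /is_interval; lia.
have : (s, Ordinal p1n) \in signed_interval s p.
  by rewrite mem_signed_interval /in_interval eqxx leqnn; case/andP: Ip.
rewrite e mem_signed_interval => /andP[/eqP /= ss' _]; split=> //.
have := sub_signed_interval s q Ip; have := sub_signed_interval s p Iq.
rewrite e -ss' subxx; move: p q {Ip Iq e p1n} => [a b] [c d].
by rewrite /subinterval /= => *; congr (_, _); lia.
Qed.

Lemma weakly_compatible_signed_interval s p q :
  is_interval n p -> is_interval n q ->
  weakly_compatible g (signed_interval s p) (signed_interval s q) <->
  path_compatible p q.
Proof.
move=> Ip Iq; rewrite /path_compatible; split=> [[|| [disj noedge]]|/or4P[pq|qp|pq|qp]].
- by rewrite sub_signed_interval // => ->.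
- by rewrite sub_signed_interval // => ->; rewrite orbT.
- move: Ip Iq => /andP[p12 p2] /andP[q12 q2].
  have in_p (i : 'I_n) : in_interval p i -> (s, i) \in signed_interval s p.
    by rewrite mem_signed_interval eqxx.
  have in_q (i : 'I_n) : in_interval q i -> (s, i) \in signed_interval s q.
    by rewrite mem_signed_interval eqxx.
  have disj_pq (i : 'I_n) : in_interval p i -> ~~ in_interval q i.
    move=> /in_p ip; apply/negP => /in_q iq.
    by move/finset.setP/(_ (s, i)): disj; rewrite finset.in_setI ip iq finset.in_set0.
  have far (i j : 'I_n) : in_interval p i -> in_interval q j ->
      ~~ ((i.+1 == j) || (j.+1 == i)).
    by move=> /in_p ip /in_q jq; have := noedge _ _ ip jq; rewrite /double_path eqxx.
  have p1n : (p.1 < n)%N by lia.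
  have p2n : (p.2.-1 < n)%N by lia.
  have q1n : (q.1 < n)%N by lia.
  have q2n : (q.2.-1 < n)%N by lia.
  (* Disjointness at the first index of each interval, and no edge from the last index of one to the
     first of the other, leave only a gap. *)
  have := disj_pq (Ordinal p1n); have := disj_pq (Ordinal q1n).
  have := far (Ordinal p2n) (Ordinal q1n); have := far (Ordinal p1n) (Ordinal q2n).
  by rewrite /in_interval /=; lia.
- by apply: Or31; rewrite sub_signed_interval.
- by apply: Or32; rewrite sub_signed_interval.
- apply: Or33; split=> [|x y].
    apply/finset.setP => x; rewrite finset.in_setI !mem_signed_interval.
    rewrite finset.in_set0 /in_interval.
    by case: eqP => //= _; lia.
  rewrite !mem_signed_interval /in_interval /double_path.
  by move=> /andP[/eqP-> xp] /andP[/eqP-> yq]; rewrite eqxx /=; lia.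
- apply: Or33; split=> [|x y].
    apply/finset.setP => x; rewrite finset.in_setI !mem_signed_interval.
    rewrite finset.in_set0 /in_interval.
    by case: eqP => //= _; lia.
  rewrite !mem_signed_interval /in_interval /double_path.
  by move=> /andP[/eqP-> xp] /andP[/eqP-> yq]; rewrite eqxx /=; lia.
Qed.

(** No edge joins the two paths. The intervals may share indices: only the condition on the union of
    a tubing excludes this. *)
Lemma weakly_compatible_opp s p q :
  weakly_compatible g (signed_interval s p) (signed_interval (~~ s) q).
Proof.
apply: Or33; split=> [|x y]; last first.
  rewrite !mem_signed_interval /double_path => /andP[/eqP-> _] /andP[/eqP-> _].
  by case: (s).
apply/finset.setP => x; rewrite finset.in_setI !mem_signed_interval finset.in_set0.
by case: eqP => //= ->; case: s; rewrite andbF.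
Qed.

Lemma tube_signed_interval s p : is_interval n p -> tube g (signed_interval s p).
Proof.
move=> /andP[p12 p2]; set t := signed_interval s p.
have p1n : (p.1 < n)%N by lia.
pose x0 : spm n := (s, Ordinal p1n).
have sym : connect_sym (induced g t).
  apply: sym_connect_sym => x y.
  by rewrite /induced /double_path andbCA eq_sym; congr [&& _, _, _ & _]; rewrite orbC.
(* Any vertex is joined to the first one by stepping down through the interval. *)
have conn0 x : x \in t -> connect (induced g t) x0 x.
  have [m] := ubnP (x.2 : nat); elim: m x => // m IHm [s' i] /= im xt.
  have := xt; rewrite mem_signed_interval /in_interval => /andP[/eqP /= es xi].
  have [i0|i0] := eqVneq (i : nat) p.1.
    have -> : (s', i) = x0 by rewrite es; congr (_, _); apply: val_inj.
    exact: connect0.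
  have i1n : (i.-1 < n)%N by apply: leq_ltn_trans (leq_pred i) (ltn_ord i).
  have yt : (s, Ordinal i1n) \in t.
    by rewrite mem_signed_interval eqxx /in_interval /=; lia.
  apply: connect_trans (IHm _ _ yt) (connect1 _); first by rewrite /=; lia.
  by rewrite /induced yt xt /double_path /= es eqxx; lia.
split.
- apply/set0Pn; exists x0; rewrite mem_signed_interval eqxx /in_interval /=; lia.
- by move=> x y xt yt; apply: connect_trans (conn0 y yt); rewrite sym; apply: conn0.
- move=> x; rewrite !mem_signed_interval /spm_opp /= => [[/andP[/eqP-> _] /andP[]]].
  by case: (s).
Qed.

Lemma tubeP t : tube g t <->
  exists s p, is_interval n p /\ t = signed_interval s p.
Proof.
split=> [|[s [p [Ip ->]]]]; last exact: tube_signed_interval.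
move=> [/set0Pn[[s i] it] conn _].
(* Edges preserve signs, so a tube lies in one of the two paths. *)
have sgn x : x \in t -> x.1 = s.
  have cl : fingraph.closed (induced g t) [pred y : spm n | y.1 == s].
    by move=> y z /and3P[_ _ /andP[/eqP yz _]]; rewrite !inE yz.
  move=> xt; have := closed_connect cl (conn _ _ it xt).
  by rewrite !inE eqxx => /esym/eqP.
pose mem k := [exists j : 'I_n, (j == k :> nat) && ((s, j) \in t)].
have memE (j : 'I_n) : mem j = ((s, j) \in t).
  apply/existsP/idP => [[k /andP[/eqP/val_inj-> //]]|jt].
  by exists j; rewrite eqxx.
have mem_lt k : mem k -> (k < n)%N by case/existsP=> j /andP[/eqP<- _].
have mem_ex : exists k, mem k by exists i; rewrite memE.
have mem_le k : mem k -> (k <= n)%N by move/mem_lt/ltnW.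
case: (ex_minnP mem_ex) => a mem_a a_min.
case: (ex_maxnP mem_ex mem_le) => b mem_b b_max.
exists s, (a, b.+1); split; first by rewrite /is_interval /= ltnS a_min ?mem_lt.
apply/finset.setP => [[s' k]]; rewrite mem_signed_interval /in_interval ltnS /=.
apply/idP/andP => [kt|[/eqP-> /andP[ak kb]]].
  have ss' : s' = s := sgn _ kt; rewrite ss' in kt *.
  by rewrite eqxx a_min ?b_max // memE.
apply/negPn/negP => kNt.
pose A := Ordinal (mem_lt _ mem_a); pose B := Ordinal (mem_lt _ mem_b).
have At : (s, A) \in t by rewrite -memE.
have Bt : (s, B) \in t by rewrite -memE.
(* If an index [k] between the extremes were missing, no edge inside [t] could jump over it, so the
   vertices below [k] would be closed under adjacency and [A] would not be connected to [B]. *)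
have below : fingraph.closed (induced g t) [pred x : spm n | (x.2 < k)%N].
  have neq (z : spm n) : z \in t -> (z.2 : nat) <> k.
    move=> zt /val_inj zk; case/negP: kNt.
    by rewrite -zk -(sgn z zt); case: z {zk} zt.
  move=> [sx x] [sy y] /and3P[/neq /= xk /neq /= yk /andP[_ /= xy]].
  by rewrite !inE /=; lia.
have := closed_connect below (conn _ _ At Bt); rewrite !inE /=.
have ka : a != k by apply: contraNneq kNt => ak'; rewrite -memE -ak'.
by move: ak kb ka; lia.
Qed.

End Tubes.

(** * Tubing cones as intersections of cluster cones *)

Section TubingCones.
Variables (R : realType) (n : nat).
Local Notation g := (@double_path n).
Local Notation interval_vec := (@interval_vec R n).
Implicit Types (p q : nat * nat) (T : {set {set spm n}}).

Lemma sum_spm_vec s p : \sum_(x in signed_interval n s p) spm_vec R x =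
  (-1) ^+ s *: interval_vec p.
Proof.
apply/rowP => j; rewrite summxE big_mkcond (bigD1 (s, j)) //= big1 => [|[s' i] ij].
  rewrite mem_signed_interval eqxx /= !mxE !eqxx addr0.
  by case: ifP; rewrite ?mulr1 ?mulr0.
rewrite mem_signed_interval /=; case: andP => // [[/eqP ss' _]].
rewrite !mxE /= (_ : j == i = false) ?mulr0 //.
by apply: contraNF ij => /eqP->; rewrite ss'.
Qed.

Definition tubing_intervals T s : set (nat * nat) :=
  [set p | is_interval n p /\ signed_interval n s p \in T].

Lemma tubing_generators T : (forall t, t \in T -> tube g t) ->
  [set \sum_(x in t) spm_vec R x | t in [set` T]] =
  interval_vec @` tubing_intervals T false `|`
  -%R @` (interval_vec @` tubing_intervals T true).
Proof.
move=> tubes; apply/seteqP; split=> [_ [t /= tT <-]|].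
  have /tubeP[s [p [Ip et]]] := tubes t tT; rewrite et in tT *.
  rewrite sum_spm_vec; case: s tT {et} => pT; [right|left].
    by exists (interval_vec p); [exists p|rewrite scaleN1r].
  by exists p; rewrite ?scale1r.
move=> _ [[p [Ip pT] <-]|[_ [p [Ip pT] <-] <-]].
  by exists (signed_interval n false p) => //; rewrite sum_spm_vec scale1r.
by exists (signed_interval n true p) => //; rewrite sum_spm_vec scaleN1r.
Qed.

(** Tubes of opposite signs are always weakly compatible, so the two halves of a tubing interact
    only through the condition on its union. *)
Lemma tubing_double_path T : (forall t, t \in T -> tube g t) ->
  tubing g T <->
  (forall s p q, tubing_intervals T s p -> tubing_intervals T s q ->
     path_compatible p q) /\
  (forall p q (i : 'I_n), tubing_intervals T false p -> tubing_intervals T true q ->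
     in_interval p i -> ~~ in_interval q i).
Proof.
move=> tubes; split=> [[_ compT oppT]|[compT oppT]].
  split=> [s p q [Ip pT] [Iq qT]|p q i [Ip pT] [Iq qT] pi].
    by apply/(weakly_compatible_signed_interval s Ip Iq)/compT.
  apply/negP => qi; apply: (oppT (false, i)); split; apply/bigcupP.
    by exists (signed_interval n false p); rewrite // mem_signed_interval eqxx.
  by exists (signed_interval n true q); rewrite // mem_signed_interval eqxx.
split=> // [t u tT uT|[s i] [/bigcupP[t tT it] /bigcupP[u uT iu]]].
  have /tubeP[s [p [Ip et]]] := tubes t tT; have /tubeP[s' [q [Iq eu]]] := tubes u uT.
  rewrite et eu in tT uT *; have [ss'|ss'] := eqVneq s' s.
    by rewrite ss' in uT *; apply/weakly_compatible_signed_interval/(compT s).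
  have -> : s' = ~~ s by case: s s' ss' {tT uT et eu} => [] [].
  exact: weakly_compatible_opp.
have /tubeP[r [p [Ip et]]] := tubes t tT; have /tubeP[r' [q [Iq eu]]] := tubes u uT.
rewrite et eu in tT uT it iu; move: it iu; rewrite !mem_signed_interval /spm_opp /=.
move=> /andP[/eqP es pi] /andP[/eqP es' qi]; rewrite -es -es' in tT uT.
have opp p' q' : tubing_intervals T false p' -> tubing_intervals T true q' ->
    in_interval p' i -> in_interval q' i -> False.
  by move=> Tp Tq /(oppT _ _ _ Tp Tq)/negP.
by case: s {es es'} tT uT => /= tT uT; [apply: (opp q p)|apply: (opp p q)].
Qed.

Lemma tubing_fan_double_path : @tubing_fan n g R =
  [set C | exists P N P' N', [/\ cluster_data P N, cluster_data P' N' &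
     C = cone (@cluster_gens R n P N) `&` -%R @` cone (@cluster_gens R n P' N')]].
Proof.
apply/seteqP; split=> [_ [T tT <-]|_ [P [N [P' [N' [dPN dPN' ->]]]]]].
  have tubes : forall t, t \in T -> tube g t by case: tT.
  have [compT oppT] := (tubing_double_path tubes).1 tT.
  pose P s := tubing_intervals T s.
  (* [N s] collects the indices covered by the half of the other sign, so that [supported_in]
     retains every interval of that half. *)
  pose N s : set 'I_n := [set i | exists2 p, P (~~ s) p & in_interval p i].
  have dPN s : cluster_data (P s) (N s).
    split=> [p []//|p q|p i Pp [q Pq qi]]; first exact: compT.
    apply/negP => pi; case: s Pp Pq => Pp Pq.
      by case/negP: (oppT q p i Pq Pp qi).
    by case/negP: (oppT p q i Pp Pq pi).
  have supp s : supported_in (P s) (N (~~ s)) = P s.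
    apply/seteqP; split=> [p []//|p Pp]; split=> // i pi.
    by exists p; rewrite ?negbK.
  exists (P false), (N false), (P true), (N true); split=> //.
  rewrite cluster_cone_setI // (supp false) (supp true) tubing_generators //.
(* Conversely, [S s] collects the intervals that [cluster_cone_setI] retains, and [T] turns them
   into tubes of sign [s]. *)
pose S s := if s then supported_in P' N else supported_in P N'.
pose T : {set {set spm n}} :=
  [set t | `[< exists s p,
    [/\ is_interval n p, t = signed_interval n s p & S s p] >]]%SET.
have [PI PP PN] := dPN; have [PI' PP' PN'] := dPN'.
have SI s p : S s p -> is_interval n p by case: s => [[/PI']|[/PI]].
have TS s : tubing_intervals T s = S s.
  apply/seteqP; split=> [p [Ip]|p Sp].
    rewrite inE => /asboolP[s' [q [Iq e Sq]]].
    by have [-> ->] := signed_interval_inj Ip Iq e.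
  have Ip := SI s p Sp; split=> //; rewrite inE; apply/asboolP.
  by exists s, p.
have tubes t : t \in T -> tube g t.
  by rewrite inE => /asboolP[s [p [Ip -> _]]]; apply: tube_signed_interval.
exists T; last by rewrite tubing_generators // !TS cluster_cone_setI.
apply/(tubing_double_path tubes); rewrite !TS; split=> [s p q|p q i].
  by rewrite TS; case: s => [[Pp _] [Pq _]|[Pp _] [Pq _]]; [apply: PP'|apply: PP].
(* The index [i] of [p] lies in [N'], which the intervals of [P'] avoid. *)
move=> [Pp pN'] [Pq _] pi; apply: PN' => //; exact: pN'.
Qed.

End TubingCones.

Theorem proposition6p1p22 (R : realType) (n : nat) (P : set 'rV[R]_n)
    (compat : 'S_n.+1 -> 'rV[R]_n.+1 -> 'rV[R]_n.+1 -> Prop)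
    (hcompat : compatibility_family compat)
    (hP : standard_cut_graph_associahedron (@double_path n) P) :
  [set (@identification R n) @` C | C in normal_fan P] =
  bicluster_fan (compat (linear_coxeter n)).
Proof.
case: hP => _ ->; rewrite tubing_fan_double_path /bicluster_fan cluster_fan_linear //.
(* Linearity gives one inclusion; the other needs injectivity, to identify the preimages of a common
   point in the two cones. *)
have identI (A B : set 'rV[R]_n) : (@identification R n) @` (A `&` -%R @` B) =
    (@identification R n) @` A `&` -%R @` ((@identification R n) @` B).
  apply/seteqP; split=> [_ [x [Ax [y By yx]] <-]|_ [[x Ax <-] [_ [y By <-] /= yx]]].
    split; first by exists x.
    by exists (identification y); [exists y|rewrite -yx linearN].
  exists x => //; split=> //; exists y => //.
  by apply: identification_inj; rewrite linearN.
apply/seteqP; split=> [_ [_ [Q [N [Q' [N' [dQ dQ' ->]]]]] <-]|].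
  rewrite identI; exists (identification (n:=n) @` cone (cluster_gens Q N)).
    by exists Q, N.
  exists (identification (n:=n) @` cone (cluster_gens Q' N')) => //.
  by exists Q', N'.
move=> _ [_ [Q [N [dQ ->]]] [_ [Q' [N' [dQ' ->]]] <-]].
rewrite -identI; eexists; last by [].
by exists Q, N, Q', N'.
Qed.
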